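(* Let $\rho\ge 0$, let $T=\{1,\dots,n\}$ be a set of targets located at points $(x_i,y_i)\in\mathbb{R}^2$, $i\in T$, and for each target $i$ let $\mathcal{I}_i$ be a partition of the set of angles $[0,2\pi]$ into finitely many (at least one) closed intervals. Then the optimal cost of the Bounding Problem (BP) associated with these data is a lower bound on the optimal cost of the Dubins Traveling Salesman Problem (DTSP) on the same targets with the same $\rho$.
   Context: Angles are headings in the plane, measured counterclockwise from the positive $x$-axis and identified modulo $2\pi$. A configuration is a triple $(x,y,\theta)$: a position $(x,y)$ and a heading $\theta$. A feasible path is a continuously differentiable planar curve whose radius of curvature is everywhere at least $\rho$. For targets $i,j$ and angles $\theta_{id},\theta_{ja}$, $d_{ij}(\theta_{id},\theta_{ja})$ denotes the length of a shortest feasible path from the configuration $(x_i,y_i,\theta_{id})$ (departure from $i$) to the configuration $(x_j,y_j,\theta_{ja})$ (arrival at $j$). DTSP: find a closed feasible path (tour) of minimal length that visits each target at least once. In particular the heading with which the tour arrives at a target on a visit equals the heading with which it departs. For each target $i$, $\mathcal{I}_i=\{[0,\varphi_{i1}],[\varphi_{i1},\varphi_{i2}],\dots,[\varphi_{i,m_i-1},\varphi_{i m_i}]\}$, where $m_i\ge 1$ is the number of intervals and $0\le\varphi_{i1}\le\varphi_{i2}\le\dots\le\varphi_{i m_i}=2\pi$ are constants. For $I_i\in\mathcal{I}_i$ and $I_j\in\mathcal{I}_j$ define $$d^*_{ij}(I_i,I_j):=\min_{\theta_{id}\in I_i,\ \theta_{ja}\in I_j} d_{ij}(\theta_{id},\theta_{ja}).$$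 Bounding Problem (BP): find a sequence $(s_1,\dots,s_n)$ of targets $s_i\in T$ in which each target is visited at least once, and an interval $I_{s_i}\in\mathcal{I}_{s_i}$ for each $s_i$, such that the cost $$\sum_{i=1}^{n-1} d^*_{s_i s_{i+1}}(I_{s_i},I_{s_{i+1}})+d^*_{s_n s_1}(I_{s_n},I_{s_1})$$ is minimized. (At each target the arrival and departure angles must lie in the same chosen interval but need not be equal.) *)

(* Defs.v *)
From HB Require Import structures.
From mathcomp Require Import all_boot all_order all_algebra.
From mathcomp Require Import all_classical all_reals all_analysis.

Set Implicit Arguments.
Unset Strict Implicit.
Unset Printing Implicit Defensive.

Import Order.TTheory GRing.Theory Num.Theory.
Import numFieldNormedType.Exports.

Local Open Scope classical_set_scope.
Local Open Scope ring_scope.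

(* A path of length L is an arc-length parametrized C^1 curve s |-> (X s, Y s),
   s in [0, L].  The functions are total on R and only their germs along
   [0, L] matter; asking for two-sided derivatives at 0 and L is no
   restriction, since a C^1 curve on [0, L] extends tangentially.  For L = 0
   the derivative at 0 records the heading of the constant path.
   A C^1 curve need not have a second derivative, so the bound on the radius of
   curvature is understood as in Dubins (1957): the unit tangent is
   1/rho-Lipschitz in arc length.  It is void for rho = 0. *)
Definition feasible_path (R : realType) (rho L : R) (X Y : R -> R) : Prop :=
  [/\ 0 <= L,
      forall s : R, s \in `[0, L] -> derivable X s 1 /\ derivable Y s 1,
      {within `[0, L], continuous (derive1 X)} /\
        {within `[0, L], continuous (derive1 Y)},
      forall s : R, s \in `[0, L] -> derive1 X s ^+ 2 + derive1 Y s ^+ 2 = 1 &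
      forall s t : R, s \in `[0, L] -> t \in `[0, L] ->
        rho * Num.sqrt ((derive1 X s - derive1 X t) ^+ 2 +
                        (derive1 Y s - derive1 Y t) ^+ 2)
          <= `|s - t| ].

Definition has_configuration (R : realType) (X Y : R -> R) (s : R)
    (p : R * R) (theta : R) : Prop :=
  [/\ X s = p.1, Y s = p.2,
      derive1 X s = cos theta & derive1 Y s = sin theta].

Definition feasible_path_between (R : realType) (rho L : R) (X Y : R -> R)
    (p : R * R) (theta : R) (q : R * R) (theta' : R) : Prop :=
  [/\ feasible_path rho L X Y, has_configuration X Y 0 p theta &
      has_configuration X Y L q theta'].

(* Minima are rendered as infima in the extended reals; for rho = 0 a shortest
   C^1 path with prescribed headings need not exist. *)
Definition dubins_dist (R : realType) (rho : R)
    (p : R * R) (theta : R) (q : R * R) (theta' : R) : \bar R :=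
  ereal_inf [set L%:E | L in [set L : R |
    exists X Y, feasible_path_between rho L X Y p theta q theta']].

Definition dubins_dist_itv (R : realType) (rho : R)
    (p : R * R) (I : set R) (q : R * R) (J : set R) : \bar R :=
  ereal_inf [set dubins_dist rho p a.1 q a.2 | a in I `*` J].

Definition angle_partition (R : realType) (F : set (set R)) : Prop :=
  exists (m : nat) (phi : nat -> R),
    [/\ (0 < m)%N, phi 0%N = 0, phi m = 2 * pi,
        forall k, (k < m)%N -> phi k <= phi k.+1 &
        F = [set [set` `[phi k, phi k.+1]] | k in `I_m]].

(* ordS k is the cyclic successor of k, so the term with k = n.-1 is the
   closing term from the last target of the sequence to the first. *)
Definition BP_cost (R : realType) (n : nat) (rho : R) (p : 'I_n -> R * R)
    (s : n.-tuple 'I_n) (I : 'I_n -> set R) : \bar R :=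
  (\sum_(k < n)
     dubins_dist_itv rho (p (tnth s k)) (I (tnth s k))
       (p (tnth s (ordS k))) (I (tnth s (ordS k))))%E.

Definition BP_opt (R : realType) (n : nat) (rho : R) (p : 'I_n -> R * R)
    (F : 'I_n -> set (set R)) : \bar R :=
  ereal_inf [set c | exists (s : n.-tuple 'I_n) (I : 'I_n -> set R),
    [/\ forall i, i \in s, forall i, F i (I i) & c = BP_cost rho p s I]].

Definition DTSP_tour (R : realType) (n : nat) (rho : R) (p : 'I_n -> R * R)
    (L : R) (X Y : R -> R) : Prop :=
  [/\ feasible_path rho L X Y,
      X L = X 0 /\ Y L = Y 0,
      derive1 X L = derive1 X 0 /\ derive1 Y L = derive1 Y 0 &
      forall i, exists2 s : R, s \in `[0, L] & (X s, Y s) = p i].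

Definition DTSP_opt (R : realType) (n : nat) (rho : R)
    (p : 'I_n -> R * R) : \bar R :=
  ereal_inf [set L%:E | L in [set L : R | exists X Y, DTSP_tour rho p L X Y]].

(* Main.v *)
Require Import Defs.
From HB Require Import structures.
From mathcomp Require Import all_boot all_order all_algebra.
From mathcomp Require Import all_classical all_reals all_analysis.
From mathcomp Require Import ring lra.

Import Order.TTheory GRing.Theory Num.Theory.
Import numFieldNormedType.Exports.

Local Open Scope classical_set_scope.
Local Open Scope ring_scope.

(** A tour is turned into a feasible point of the bounding problem without
    increasing the cost. Given a tour of length [L], choose for each target [i]
    a time [t i] at which it is visited, and list the targets by increasing
    [t]: this is the sequence of targets, and every target occurs in it. The
    unit tangent at time [t i] has an angle in [[0, 2 * pi]]
    ([unit_vector_angle]), which lies in some interval of the partition at [i]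
    ([angle_partition_cover]): this is the interval chosen at [i].

    The arc of the tour between two consecutive visits is a feasible path with
    the chosen departure and arrival angles ([feasible_path_between_sub]), so
    that the corresponding distance is at most the length of the arc. The
    closing arc, from the last visit to the first, passes through the endpoint
    of the parametrization; it is the concatenation of the final and of the
    initial arc of the tour, which is feasible because the tour closes up with
    equal headings ([feasible_path_between_concat]). The lengths of the arcs
    telescope to [L] ([BP_cost_le_tour]), and the infimum over all tours gives
    the claim. *)

(** * Translation and concatenation of functions of a real variable *)

Lemma derivable_translate {R : realType} (f : R -> R) (c s : R) :
  derivable f (c + s) 1 -> derivable (fun s => f (c + s)) s 1.
Proof.
rewrite /derivable.
by under [X in _ -> cvg (X @ _)]eq_fun do rewrite /= addrCA.
Qed.

Lemma derive1_translate {R : realType} (f : R -> R) (c s : R) :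
  derive1 (fun s => f (c + s)) s = derive1 f (c + s).
Proof.
by rewrite /derive1; under eq_fun do rewrite addrCA.
Qed.

Lemma is_derive_derive1 {R : realType} (f : R -> R) (s : R) :
  derivable f s 1 -> is_derive s 1 f (derive1 f s).
Proof. by move=> df; rewrite derive1E; exact: derivableP. Qed.

Lemma derive1_is_derive {R : realType} (f : R -> R) (s l : R) :
  is_derive s 1 f l -> derive1 f s = l.
Proof. by move=> df; rewrite derive1E derive_val. Qed.

(** Each difference quotient of the piecewise function at [c] is the quotient
    of one of the two pieces, and both converge to [l]. *)
Lemma is_derive_if_le {R : realType} (f g : R -> R) (c l : R) : f c = g c ->
  is_derive c 1 f l -> is_derive c 1 g l ->
  is_derive c 1 (fun s => if s <= c then f s else g s) l.
Proof.
move=> fgc [df fl] [dg gl].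
set k := fun s => if s <= c then f s else g s.
have cvgf : (fun h => h^-1 *: ((f \o shift c) (h *: 1) - f c)) @ 0^' --> l.
  by rewrite -fl; exact: df.
have cvgg : (fun h => h^-1 *: ((g \o shift c) (h *: 1) - g c)) @ 0^' --> l.
  by rewrite -gl; exact: dg.
have cvgk : (fun h => h^-1 *: ((k \o shift c) (h *: 1) - k c)) @ 0^' --> l.
  apply/cvgrPdist_lt => e e0.
  move/cvgrPdist_lt : cvgf => /(_ e e0) nf.
  move/cvgrPdist_lt : cvgg => /(_ e e0) ng.
  near=> h.
  rewrite /k /= lexx; case: ifPn => _; first by near: h.
  by rewrite fgc; near: h.
by split; [apply/cvg_ex; exists l | exact/cvg_lim].
Unshelve. all: by end_near.
Qed.

(** The second piece is parametrized from time 0, as paths are; at the junction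
    [c] the first piece wins, which is harmless when [f c = g 0]. *)
Definition concat {R : realType} (c : R) (f g : R -> R) (s : R) : R :=
  if s <= c then f s else g (s - c).

Lemma concatl {R : realType} (c : R) (f g : R -> R) (s : R) :
  s <= c -> concat c f g s = f s.
Proof. by rewrite /concat => ->. Qed.

Lemma concatr {R : realType} (c : R) (f g : R -> R) (s : R) : f c = g 0 ->
  c <= s -> concat c f g s = g (s - c).
Proof.
by rewrite /concat => fg; case: ltgtP => // <- _; rewrite subrr.
Qed.

(** Since derivatives are two-sided and both pieces are differentiable in this
    sense up to their ends, equality of the one-jets at the junction suffices,
    even when a piece has length zero. *)
Lemma is_derive_concat {R : realType} (a b : R) (f g : R -> R) :
  (forall s, s \in `[0, a] -> derivable f s 1) ->
  (forall s, s \in `[0, b] -> derivable g s 1) ->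
  f a = g 0 -> derive1 f a = derive1 g 0 ->
  forall s, s \in `[0, a + b] ->
    is_derive s 1 (concat a f g) (concat a (derive1 f) (derive1 g) s).
Proof.
move=> df dg fg dfg s; rewrite in_itv /= => /andP[s0 sab].
pose h := fun s => g (- a + s).
have dh t : a <= t <= a + b -> is_derive t 1 h (derive1 g (t - a)).
  move=> tab; rewrite addrC -derive1_translate; apply: is_derive_derive1.
  by apply: derivable_translate; apply: dg; rewrite in_itv /=; lra.
have df' t : 0 <= t <= a -> is_derive t 1 f (derive1 f t).
  by move=> ta; apply: is_derive_derive1; apply: df; rewrite in_itv.
have [sa|sa|sa] := ltgtP s a.
- rewrite concatl ?ltW//.
  apply: (near_eq_is_derive (f := f)); last by apply: df'; lra.
  near=> t; rewrite concatl// ltW//; near: t; exact: lt_nbhsl.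
- rewrite concatr ?ltW//.
  apply: (near_eq_is_derive (f := h)); last by apply: dh; lra.
  near=> t; rewrite concatr// ?ltW// /h 1?addrC//; near: t; exact: lt_nbhsr.
- subst s; rewrite concatl//.
  have -> : concat a f g = fun s => if s <= a then f s else h s.
    by apply/funext => t; rewrite /concat /h [- a + _]addrC.
  apply: is_derive_if_le.
  + by rewrite /h addNr.
  + by apply: df'; lra.
  + by rewrite dfg -[X in derive1 g X](subrr a); apply: dh; lra.
Unshelve. all: by end_near.
Qed.

Lemma continuous_translate_itv {R : realType} (f : R -> R) (c a b a' b' : R) :
  a' <= a + c -> b + c <= b' -> {within `[a', b'], continuous f} ->
  {within `[a, b], continuous (fun s => f (c + s))}.
Proof.
move=> aa bb cf; apply/subspace_continuousP => x; rewrite /= in_itv/= => xab.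
have /subspace_continuousP/(_ (c + x)) := cf.
rewrite /= in_itv/= => /(_ ltac:(lra)).
move=> /cvgrPdist_lt H; apply/cvgrPdist_lt => e e0.
have := H e e0; rewrite !near_withinE => /nbhs_ballP[d /= d0 Hd].
apply/nbhs_ballP; exists d => // y xy; rewrite in_itv/= => yab.
apply: Hd; last by rewrite in_itv/=; lra.
by move: xy; rewrite /ball /= opprD addrACA subrr add0r.
Qed.

(** Pasting along the closed cover of [[0, a + b]] by the domains of the two
    pieces. *)
Lemma continuous_concat {R : realType} (a b : R) (f g : R -> R) :
  0 <= a -> 0 <= b -> f a = g 0 ->
  {within `[0, a], continuous f} -> {within `[0, b], continuous g} ->
  {within `[0, a + b], continuous (concat a f g)}.
Proof.
move=> a0 b0 fg cf cg.
have -> : [set` `[0, a + b]] = `[0, a] `|` `[a, a + b] :> set R.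
  apply/seteqP; split=> x /=; rewrite !in_itv/=.
    by have [xa|xa] := leP x a; [left|right]; lra.
  by case; lra.
apply: withinU_continuous; [exact: itv_closed..| |].
  apply: subspace_eq_continuous cf => x; rewrite inE/= in_itv/= => /andP[_ xa].
  by rewrite /from_subspace concatl.
apply: (@subspace_eq_continuous _ _ _ (fun s => g (- a + s))); last first.
  by apply: (@continuous_translate_itv R g (- a) _ _ 0 b) => //; lra.
move=> x; rewrite inE/= in_itv/= => /andP[ax _].
by rewrite /from_subspace concatr// addrC.
Qed.

(** * Arcs and concatenations of feasible paths *)

(** Minkowski's inequality in the plane, in the form in which the curvature
    bound measures the change of heading; squaring reduces it to
    Cauchy-Schwarz, that is to [0 <= (a * d - b * c) ^+ 2]. *)
Lemma sqrt_sum_sqrD {R : realType} (a b c d : R) :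
  Num.sqrt ((a + c) ^+ 2 + (b + d) ^+ 2) <=
  Num.sqrt (a ^+ 2 + b ^+ 2) + Num.sqrt (c ^+ 2 + d ^+ 2).
Proof.
set u := Num.sqrt (a ^+ 2 + b ^+ 2); set v := Num.sqrt (c ^+ 2 + d ^+ 2).
have u0 : 0 <= u by exact: sqrtr_ge0.
have v0 : 0 <= v by exact: sqrtr_ge0.
have uE : u ^+ 2 = a ^+ 2 + b ^+ 2 by rewrite sqr_sqrtr// addr_ge0 ?sqr_ge0.
have vE : v ^+ 2 = c ^+ 2 + d ^+ 2 by rewrite sqr_sqrtr// addr_ge0 ?sqr_ge0.
have uv : a * c + b * d <= u * v.
  apply: le_trans (ler_norm _) _.
  rewrite -(ler_pXn2r (n := 2)) ?nnegrE ?mulr_ge0// real_normK ?num_real//.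
  rewrite exprMn uE vE -subr_ge0.
  by rewrite (_ : _ - _ = (a * d - b * c) ^+ 2) ?sqr_ge0//; ring.
rewrite -(ler_pXn2r (n := 2)) ?nnegrE ?addr_ge0 ?sqrtr_ge0//.
rewrite sqr_sqrtr ?addr_ge0 ?sqr_ge0// [leRHS]sqrrD uE vE; lra.
Qed.

Lemma feasible_path_sub {R : realType} (rho L : R) (X Y : R -> R) (a b : R) :
  feasible_path rho L X Y -> 0 <= a -> a <= b -> b <= L ->
  feasible_path rho (b - a) (fun s => X (a + s)) (fun s => Y (a + s)).
Proof.
move=> [L0 dXY [cX cY] unit curv] a0 ab bL.
have sub s : s \in `[0, b - a] -> a + s \in `[0, L].
  by rewrite !in_itv/=; lra.
split.
- by rewrite subr_ge0.
- by move=> s /sub /dXY[dX dY]; split; exact: derivable_translate.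
- have dE (f : R -> R) :
      derive1 (fun s => f (a + s)) = (fun s => derive1 f (a + s)).
    by apply/funext => s; exact: derive1_translate.
  rewrite !dE.
  by split; apply: (@continuous_translate_itv R _ a _ _ 0 L) => //; lra.
- by move=> s /sub sL; rewrite !derive1_translate; exact: unit.
- move=> s t /sub sL /sub tL; rewrite !derive1_translate.
  by apply: le_trans (curv _ _ sL tL) _; rewrite opprD addrACA subrr add0r.
Qed.

Lemma feasible_path_between_sub {R : realType} (rho L : R) (X Y : R -> R)
    (a b : R) (p q : R * R) (theta theta' : R) :
  feasible_path rho L X Y -> 0 <= a -> a <= b -> b <= L ->
  has_configuration X Y a p theta -> has_configuration X Y b q theta' ->
  feasible_path_between rho (b - a) (fun s => X (a + s)) (fun s => Y (a + s))
    p theta q theta'.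
Proof.
move=> path a0 ab bL [Xa Ya dXa dYa] [Xb Yb dXb dYb]; split.
- exact: feasible_path_sub path a0 ab bL.
- by split; rewrite ?derive1_translate addr0.
- by split; rewrite ?derive1_translate subrKC.
Qed.

(** The curvature bound is a Lipschitz bound on the unit tangent, hence it
    passes through the junction: for times on either side of it, add the bounds
    up to the junction and from it on. *)
Lemma feasible_path_concat {R : realType} (rho a b : R) (X Y X' Y' : R -> R) :
  0 <= rho -> feasible_path rho a X Y -> feasible_path rho b X' Y' ->
  X a = X' 0 -> Y a = Y' 0 ->
  derive1 X a = derive1 X' 0 -> derive1 Y a = derive1 Y' 0 ->
  feasible_path rho (a + b) (concat a X X') (concat a Y Y').
Proof.
move=> rho0 [a0 dXY [cX cY] unit curv] [b0 dXY' [cX' cY'] unit' curv'].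
have inl s : 0 <= s -> s <= a -> s \in `[0, a] by rewrite in_itv/= => -> ->.
have inr s : a <= s -> s <= a + b -> s - a \in `[0, b].
  by rewrite in_itv/= subr_ge0 lerBlDl => -> ->.
move=> XX YY dX dY.
have isX := is_derive_concat a b X X' (fun s h => (dXY s h).1)
  (fun s h => (dXY' s h).1) XX dX.
have isY := is_derive_concat a b Y Y' (fun s h => (dXY s h).2)
  (fun s h => (dXY' s h).2) YY dY.
have EX s : s \in `[0, a + b] ->
    derive1 (concat a X X') s = concat a (derive1 X) (derive1 X') s.
  by move=> /isX; exact: derive1_is_derive.
have EY s : s \in `[0, a + b] ->
    derive1 (concat a Y Y') s = concat a (derive1 Y) (derive1 Y') s.
  by move=> /isY; exact: derive1_is_derive.
split.
- exact: addr_ge0.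
- move=> s sab; split; first exact: (@ex_derive _ _ _ _ _ _ _ (isX s sab)).
  exact: (@ex_derive _ _ _ _ _ _ _ (isY s sab)).
- split.
  + apply: subspace_eq_continuous (continuous_concat a b _ _ a0 b0 dX cX cX').
    by move=> s; rewrite inE/= => /EX.
  + apply: subspace_eq_continuous (continuous_concat a b _ _ a0 b0 dY cY cY').
    by move=> s; rewrite inE/= => /EY.
- move=> s sab; rewrite EX// EY//; move: sab; rewrite in_itv/= => /andP[s0 sab].
  have [sa|/ltW sa] := leP s a.
    by rewrite !concatl//; apply: unit; exact: inl.
  by rewrite !concatr//; apply: unit'; exact: inr.
- move=> s t sab tab; rewrite !EX// !EY//; move: sab tab; rewrite !in_itv/=.
  wlog st : s t / s <= t.
    move=> th sab tab; have [st|/ltW ts] := leP s t; first exact: th.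
    rewrite distrC (le_trans _ (th t s ts tab sab))//.
    by rewrite -(sqrrN (_ - _)) opprB -[X in _ + X]sqrrN opprB.
  move=> /andP[s0 sab] /andP[t0 tab].
  have [ta|/ltW ta] := leP t a.
    have sa := le_trans st ta.
    by rewrite !concatl//; apply: curv; exact: inl.
  have [sa|/ltW sa] := leP s a; last first.
    rewrite !concatr//.
    apply: le_trans (curv' _ _ (inr _ sa sab) (inr _ ta tab)) _.
    by rewrite opprB addrA subrK.
  rewrite !(concatl _ _ _ s)// !(concatr _ _ _ t)//.
  have h1 := curv s a (inl _ s0 sa) (inl _ a0 (lexx a)).
  have /curv'/(_ (inr _ ta tab)) h2 : 0 \in `[0, b] by rewrite in_itv/= lexx.
  rewrite -dX -dY in h2.
  rewrite (_ : `|s - t| = `|s - a| + `|0 - (t - a)|); last first.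
    by rewrite sub0r !ler0_norm ?subr_le0 ?oppr_le0 ?subr_ge0//; ring.
  apply: le_trans (lerD h1 h2); rewrite -mulrDr ler_wpM2l//.
  by apply: le_trans (sqrt_sum_sqrD _ _ _ _); rewrite !addrA !subrK.
Qed.

Lemma feasible_path_between_concat {R : realType} (rho a b : R)
    (X Y X' Y' : R -> R) (p q r : R * R) (theta1 theta2 theta3 : R) :
  0 <= rho -> feasible_path_between rho a X Y p theta1 q theta2 ->
  feasible_path_between rho b X' Y' q theta2 r theta3 ->
  feasible_path_between rho (a + b) (concat a X X') (concat a Y Y')
    p theta1 r theta3.
Proof.
move=> rho0 [pathX [X0 Y0 dX0 dY0] [Xa Ya dXa dYa]].
move=> [pathX' [X'0 Y'0 dX'0 dY'0] [X'b Y'b dX'b dY'b]].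
have [a0 dXY _ _ _] := pathX; have [b0 dXY' _ _ _] := pathX'.
have XX : X a = X' 0 by rewrite Xa X'0.
have YY : Y a = Y' 0 by rewrite Ya Y'0.
have dX : derive1 X a = derive1 X' 0 by rewrite dXa dX'0.
have dY : derive1 Y a = derive1 Y' 0 by rewrite dYa dY'0.
have isX s sab := derive1_is_derive _ _ _ (is_derive_concat a b X X'
  (fun s h => (dXY s h).1) (fun s h => (dXY' s h).1) XX dX s sab).
have isY s sab := derive1_is_derive _ _ _ (is_derive_concat a b Y Y'
  (fun s h => (dXY s h).2) (fun s h => (dXY' s h).2) YY dY s sab).
have ab0 : 0 \in `[0, a + b] by rewrite in_itv/= lexx addr_ge0.
have abab : a + b \in `[0, a + b] by rewrite in_itv/= lexx addr_ge0.
have aab : a <= a + b by rewrite lerDl.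
split.
- exact: feasible_path_concat.
- by split; rewrite ?isX ?isY// concatl.
- by split; rewrite ?isX ?isY// concatr// [a + b]addrC addrK.
Qed.

(** * Headings and partitions of the angles *)

Lemma unit_vector_angle {R : realType} (a b : R) : a ^+ 2 + b ^+ 2 = 1 ->
  exists theta, [/\ 0 <= theta <= 2 * pi, a = cos theta & b = sin theta].
Proof.
move=> ab.
have a1 : -1 <= a <= 1.
  rewrite -ler_norml -(@expr_le1 _ 2)// real_normK ?num_real//.
  by rewrite -ab lerDl sqr_ge0.
have ca : cos (acos a) = a by apply: acosK; rewrite in_itv.
have sa : sin (acos a) = `|b|.
  by rewrite sin_acos// -ab [X in X - _]addrC addrK sqrtr_sqr.
have h0 := acos_ge0 a1; have hpi := acos_lepi a1.
have pi0 := pi_gt0 R.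
have [b0|b0] := leP 0 b.
  by exists (acos a); rewrite ca sa ger0_norm//; split => //; lra.
(* In the lower half plane the angle is the reflection of [acos a]. *)
exists (- acos a + pi *+ 2); rewrite cosD2pi sinD2pi cosN sinN ca sa.
by rewrite ltr0_norm// opprK; split=> //; rewrite mulr2n; lra.
Qed.

Lemma angle_partition_cover {R : realType} (F : set (set R)) (theta : R) :
  angle_partition F -> 0 <= theta <= 2 * pi -> exists2 I, F I & I theta.
Proof.
move=> [m [phi [m0 phi0 phim phile ->]]].
rewrite -phim -phi0; elim: m m0 {phim} phile => // m IH _ phile /andP[th0 thm].
have [thl|thl] := leP theta (phi m); last first.
  exists `[phi m, phi m.+1]%classic; first by exists m => /=.
  by rewrite /= in_itv/= thm ltW.
case: m IH phile thm thl => [|m] IH phile thm thl.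
  exists `[phi 0%N, phi 1%N]%classic; first by exists 0%N.
  by rewrite /= in_itv/= th0.
have [k km||I [k /= km <-] Ith] := IH isT; first exact/phile/ltnW.
  by rewrite th0.
by exists `[phi k, phi k.+1]%classic => //; exists k => //=; exact: ltnW.
Qed.

(** * Comparison of the two optimal costs *)

Lemma dubins_dist_itv_le {R : realType} (rho : R) (p q : R * R) (I J : set R)
    (L : R) (X Y : R -> R) (theta theta' : R) :
  I theta -> J theta' ->
  feasible_path_between rho L X Y p theta q theta' ->
  (dubins_dist_itv rho p I q J <= L%:E)%E.
Proof.
move=> Ith Jth pathL.
apply: (@le_trans _ _ (dubins_dist rho p theta q theta')).
  by apply: ereal_inf_lbound; exists (theta, theta').
by apply: ereal_inf_lbound; exists L => //; exists X, Y.
Qed.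

(** Each distance is bounded by the length of the arc of the tour between the
    corresponding visits, including the closing arc; these lengths add up to
    [L]. *)
Lemma BP_cost_le_tour {R : realType} (n : nat) (rho : R) (p : 'I_n -> R * R)
    (s : n.-tuple 'I_n) (I : 'I_n -> set R) (L : R) (X Y : R -> R)
    (t theta : 'I_n -> R) :
  (0 < n)%N -> 0 <= rho -> DTSP_tour rho p L X Y ->
  (forall i, t i \in `[0, L]) ->
  (forall i, has_configuration X Y (t i) (p i) (theta i)) ->
  (forall i, I i (theta i)) ->
  sorted (relpre t <=%R) s ->
  (BP_cost rho p s I <= L%:E)%E.
Proof.
move=> n0 rho0 [path [XL YL] [dXL dYL] _] tL conf Ith srt.
case: n n0 p s I t theta tL conf Ith srt => // n _ p s I t theta.
move=> tL conf Ith srt.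
(* The visiting times, continued by the first one on the next lap: the closing
   arc then has length [u n.+1 - u n], like the others. *)
pose u k := if (k <= n)%N then t (tnth s (inord k)) else L + t (tnth s ord0).
have -> : L%:E = (\sum_(k < n.+1) (u k.+1 - u k)%:E)%E.
  rewrite sumEFin -(big_mkord xpredT (fun k => u k.+1 - u k)) telescope_sumr//.
  rewrite /u ltnn leq0n (_ : inord 0 = ord0) ?addrK//.
  by apply/val_inj; rewrite /= inordK.
apply: lee_sum => k _.
have uk : u k = t (tnth s k) by rewrite /u -ltnS ltn_ord inord_val.
set i := tnth s k; set j := tnth s (ordS k).
have /(_ i)/[!in_itv]/= /andP[ti0 tiL] := tL.
have /(_ j)/[!in_itv]/= /andP[tj0 tjL] := tL.
rewrite uk /u -/i; case: ifPn => kn.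
- have -> : inord k.+1 = ordS k.
    by apply/val_inj; rewrite /= inordK// modn_small.
  rewrite -/j.
  have tij : t i <= t j.
    rewrite /i /j 2!(tnth_nth ord0) /= modn_small//.
    apply: (sorted_leq_nth (leT := relpre t <=%R)) => //.
    + by move=> x y z; exact: le_trans.
    + by move=> x; exact: lexx.
    + by rewrite inE size_tuple.
    + by rewrite inE size_tuple.
  apply: (dubins_dist_itv_le _ _ _ _ _ _ _ _ _ _ (Ith i) (Ith j)).
  by apply: feasible_path_between_sub path ti0 tij tjL (conf i) (conf j).
- have jE : j = tnth s ord0.
    rewrite /j; congr (tnth s _); apply/val_inj => /=.
    rewrite (_ : k.+1 = n.+1) ?modnn//.
    by apply/eqP; rewrite eqn_leq ltn_ord ltnNge.
  (* The closing arc runs from [t i] to [L], then from 0 to [t j]. *)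
  rewrite -jE (_ : _ - _ = (L - t i) + (t j - 0)); last by ring.
  have [theta0 [_ dX0 dY0]] : exists theta0, [/\ 0 <= theta0 <= 2 * pi,
      derive1 X 0 = cos theta0 & derive1 Y 0 = sin theta0].
    apply: unit_vector_angle; case: path => _ _ _ + _; apply.
    by rewrite in_itv/= lexx (le_trans ti0 tiL).
  have conf0 : has_configuration X Y 0 (X 0, Y 0) theta0 by [].
  have confL : has_configuration X Y L (X 0, Y 0) theta0.
    by split; rewrite ?dXL ?dYL.
  apply: (dubins_dist_itv_le _ _ _ _ _ _ _ _ _ _ (Ith i) (Ith j)).
  have final := feasible_path_between_sub _ _ _ _ _ _ _ _ _ _
    path ti0 tiL (lexx L) (conf i) confL.
  have initial := feasible_path_between_sub _ _ _ _ _ _ _ _ _ _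
    path (lexx 0) tj0 tjL conf0 (conf j).
  by apply: feasible_path_between_concat rho0 final initial.
Qed.

Theorem mainTheorem1 (R : realType) (n : nat) (hn : (0 < n)%N)
    (rho : R) (hrho : 0 <= rho) (p : 'I_n -> R * R)
    (F : 'I_n -> set (set R)) (hF : forall i, angle_partition (F i)) :
  (BP_opt rho p F <= DTSP_opt rho p)%E.
Proof.
apply: le_ereal_inf_tmp => _ [L [X [Y tour]] <-].
have [path _ _ visit] := tour.
have /choice[t tP] i : exists s : R, s \in `[0, L] /\ (X s, Y s) = p i.
  by have [s sL sp] := visit i; exists s.
have /choice[theta thetaP] i : exists theta : R,
    [/\ 0 <= theta <= 2 * pi, derive1 X (t i) = cos theta &
        derive1 Y (t i) = sin theta].
  apply: unit_vector_angle.
  by case: path => _ _ _ + _; apply; have [] := tP i.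
have /choice[I IP] i : exists J : set R, F i J /\ J (theta i).
  have [th _ _] := thetaP i.
  by have [J FJ Jth] := angle_partition_cover _ _ (hF i) th; exists J.
pose s := [tuple of sort (relpre t <=%R) (ord_tuple n)].
apply: (@le_trans _ _ (BP_cost rho p s I)).
  apply: ereal_inf_lbound; exists s, I; split => // i.
  - by rewrite mem_sort val_ord_tuple mem_enum.
  - by have [] := IP i.
apply: (BP_cost_le_tour _ _ _ _ _ _ _ _ t theta hn hrho tour).
- by move=> i; have [] := tP i.
- move=> i; have [_ ti] := tP i; have [_ dX dY] := thetaP i.
  by split; rewrite -?ti.
- by move=> i; have [] := IP i.
- by apply: sort_sorted => i j; exact: le_total.
Qed.
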